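(* For any $\epsilon>0$ and integers $m\ge 1$ and $p\ge 2$, there exists an $M=M(\epsilon,m,p)$ such that for each $p$-partite graph $G(V^{(1)},\dots,V^{(p)})$ with $|V^{(s)}|\ge M$ for all $1\le s\le p$, there is an integer $k$ with $m\le k\le M$ (the same $k$ for every part) and, for each $1\le s\le p$, a partition $\{V^{(s)}_1,\dots,V^{(s)}_k\}$ of $V^{(s)}$ such that (1) $\big||V^{(s)}_i|-|V^{(s)}_j|\big|\le 1$ for each $s$ and all $1\le i,j\le k$; (2) all but at most $\epsilon k^2\binom{p}{2}$ of the pairs $\big(V^{(s)}_i,V^{(t)}_j\big)$, $1\le s<t\le p$, $1\le i,j\le k$, are $\epsilon$-regular.
   Context: Graphs are finite and simple. $G(V^{(1)},\dots,V^{(p)})$ denotes a $p$-partite graph on the vertex set $\bigcup_{s=1}^p V^{(s)}$ with disjoint color classes $V^{(1)},\dots,V^{(p)}$ (no edges inside any class). For disjoint vertex sets $X,Y$, $e(X,Y)$ is the number of edges between $X$ and $Y$, and the edge density is $d(X,Y)=\frac{e(X,Y)}{|X||Y|}$. A disjoint pair $(X,Y)$ is called $\epsilon$-regular if any $X'\subseteq X$ and $Y'\subseteq Y$ with $|X'|>\epsilon|X|$ and $|Y'|>\epsilon|Y|$ satisfy $|d(X,Y)-d(X',Y')|\le\epsilon$. *)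

(* Defs.v *)
From HB Require Import structures.
From mathcomp Require Import all_boot all_order all_algebra.
From mathcomp Require Import reals.
Set Implicit Arguments. Unset Strict Implicit. Unset Printing Implicit Defensive.
Import Order.TTheory GRing.Theory Num.Theory.
Local Open Scope ring_scope.

Definition simple_graph (V : finType) (e : rel V) : Prop :=
  symmetric e /\ irreflexive e.

Definition multipartite (V : finType) (e : rel V) (p : nat)
    (C : 'I_p -> {set V}) : Prop :=
  [/\ \bigcup_(s < p) C s = [set: V],
      forall s t : 'I_p, s != t -> [disjoint C s & C t]
    & forall (s : 'I_p) (x y : V), x \in C s -> y \in C s -> ~~ e x y].

(* For disjoint X and Y each edge between them is counted exactly once. *)
Definition edges_between (V : finType) (e : rel V) (X Y : {set V}) : nat :=
  #|[set xy in setX X Y | e xy.1 xy.2]|.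

Definition density (R : realType) (V : finType) (e : rel V)
    (X Y : {set V}) : R :=
  (edges_between e X Y)%:R / (#|X|%:R * #|Y|%:R).

Definition eps_regular (R : realType) (V : finType) (e : rel V) (eps : R)
    (X Y : {set V}) : bool :=
  [disjoint X & Y] &&
  [forall X' : {set V}, forall Y' : {set V},
    [&& X' \subset X, Y' \subset Y,
        eps * #|X|%:R < #|X'|%:R & eps * #|Y|%:R < #|Y'|%:R] ==>
    (`|density R e X Y - density R e X' Y'| <= eps)].

(* Injectivity makes the family W list exactly k parts; the parts are nonempty
   because [partition] excludes set0. *)
Definition is_k_partition (V : finType) (k : nat) (W : 'I_k -> {set V})
    (A : {set V}) : Prop :=
  injective W /\ partition [set W i | i : 'I_k] A.

(* Index quadruples ((s, i), (t, j)) with s < t whose pair (W s i, W t j) is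
   not eps-regular. *)
Definition irregular_pairs (R : realType) (V : finType) (e : rel V) (eps : R)
    (p k : nat) (W : 'I_p -> 'I_k -> {set V}) :
    {set ('I_p * 'I_k) * ('I_p * 'I_k)} :=
  [set q : ('I_p * 'I_k) * ('I_p * 'I_k) |
     (q.1.1 < q.2.1)%N &&
     ~~ eps_regular e eps (W q.1.1 q.1.2) (W q.2.1 q.2.2)].

(* Main.v *)
Require Import Defs.
From HB Require Import structures.
From mathcomp Require Import all_boot all_order all_algebra.
From mathcomp Require Import reals.
From mathcomp Require Import zify ring lra.
Set Implicit Arguments. Unset Strict Implicit. Unset Printing Implicit Defensive.
Import Order.TTheory GRing.Theory Num.Theory.
Local Open Scope ring_scope.

(** A partition of each class is encoded by a colouring. Its defect is the
    normalised squared distance from the edge indicator to some function that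
    is constant on cells. For an irregular pair, shifting the constant [g] by
    [d(X, Y) - g] on a suitable subpair [X * Y] lowers the squared error
    ([g] need not be the density of the cell: if [X'], [Y'] witness
    irregularity, [g] is far from the density of [(X', Y')] or of the whole
    pair). The corrected function depends only on a bounded number of
    signatures. Sorting each class by signature and cutting it into [k'] nearly
    equal intervals, all but at most one interval per signature have a single
    signature, so the defect changes little by this equitable rounding. The
    defect is nonnegative and drops by at least [eps ^+ 5 / 32] at each round,
    so the process stops. *)

(** * Squared error and the gain on one cell *)

Definition sqerr (R : realType) (V : finType) (e : rel V) (A B : {set V})
    (G : V -> V -> R) : R :=
  \sum_(x in A) \sum_(y in B) ((e x y)%:R - G x y) ^+ 2.

Definition color_class (V T : finType) (A : {set V}) (c : V -> T) (i : T) :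
    {set V} := [set x in A | c x == i].

Definition equitable (V : finType) (A : {set V}) (k : nat) (c : V -> 'I_k) :=
  forall i, (#|A| %/ k <= #|color_class A c i| <= (#|A| %/ k).+1)%N.

Definition mixed_colors (V T I : finType) (A : {set V}) (sig : V -> T)
    (c : V -> I) : {set I} :=
  [set i | [exists x in color_class A c i, exists y in color_class A c i,
              sig x != sig y]].

Lemma edges_between_sum (R : realType) (V : finType) (e : rel V)
    (X Y : {set V}) :
  (edges_between e X Y)%:R = \sum_(x in X) \sum_(y in Y) (e x y)%:R :> R.
Proof.
rewrite pair_big /= /edges_between -sum1dep_card natr_sum.
rewrite [LHS]big_mkcond [RHS]big_mkcond /=; apply: eq_bigr => -[x y] _ /=.
by rewrite in_setX /=; case: (x \in X); case: (y \in Y); case: (e x y).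
Qed.

Lemma sumr_indicator (R : pzRingType) (V : finType) (A X : {set V})
    (F : V -> R) :
  X \subset A -> \sum_(x in A) (x \in X)%:R * F x = \sum_(x in X) F x.
Proof.
move=> XA; rewrite [LHS]big_mkcond [RHS]big_mkcond /=; apply: eq_bigr => x _.
case: (boolP (x \in X)) => [/(subsetP XA) -> |_]; first by rewrite mul1r.
by rewrite mul0r if_same.
Qed.

(* On [X * Y] the best constant correction of [g] is the mean deviation. *)
Lemma sqerr_correct (R : realType) (V : finType) (e : rel V)
    (A B X Y : {set V}) (g : R) :
  X \subset A -> Y \subset B -> (0 < #|X|)%N -> (0 < #|Y|)%N ->
  sqerr e A B
    (fun x y => g + (density R e X Y - g) * (x \in X)%:R * (y \in Y)%:R) =
  sqerr e A B (fun _ _ => g)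
    - (density R e X Y - g) ^+ 2 * (#|X|%:R * #|Y|%:R).
Proof.
move=> XA YB X0 Y0; set d := density R e X Y.
have nz : #|X|%:R * #|Y|%:R != 0 :> R by rewrite mulf_neq0 // pnatr_eq0 -lt0n.
have sumE : \sum_(x in X) \sum_(y in Y) (e x y)%:R = d * (#|X|%:R * #|Y|%:R).
  by rewrite -edges_between_sum /d /density divfK.
have sumC (a : R) : \sum_(x in X) \sum_(y in Y) a = a * (#|X|%:R * #|Y|%:R).
  by rewrite !sumr_const -[LHS]mulr_natr -[a *+ _]mulr_natr mulrAC mulrA.
(* The summand is [(e - g)^2 - (e - d)^2], expanded so that it is linear in [e]. *)
have -> : (d - g) ^+ 2 * (#|X|%:R * #|Y|%:R) =
    \sum_(x in X) \sum_(y in Y) (2 * (d - g) * ((e x y)%:R - g) - (d - g)^+2).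
  under eq_bigr do rewrite big_split /= -mulr_sumr big_split /=.
  rewrite big_split /= -mulr_sumr big_split /= sumE.
  have := sumC (- g); have := sumC (- (d-g)^+2) => -> ->; ring.
rewrite -(sumr_indicator _ XA) /sqerr -sumrB; apply: eq_bigr => x _.
rewrite -(sumr_indicator _ YB) mulr_sumr -sumrB; apply: eq_bigr => y _.
by case: (x \in X); case: (y \in Y); rewrite /= ?mulr1n ?mulr0n; ring.
Qed.

(** On an irregular cell, [g] is at least [eps / 2] away from the density of a subpair holding at
    least the fraction [eps ^+ 2] of the cell, whence the factor [eps ^+ 4 / 4]. A regular cell
    takes the zero correction. *)
Lemma cell_gain (R : realType) (V : finType) (e : rel V) (eps g : R)
    (A B : {set V}) : 0 < eps -> [disjoint A & B] ->
  exists XY : {set V} * {set V}, exists eta : R,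
   sqerr e A B
     (fun x y => g + eta * (x \in XY.1)%:R * (y \in XY.2)%:R) <=
   sqerr e A B (fun _ _ => g)
     - (~~ eps_regular e eps A B)%:R * (eps ^+ 4 / 4 * (#|A|%:R * #|B|%:R)).
Proof.
move=> e0 dAB; case: (boolP (eps_regular _ _ _ _)) => [_|].
  exists (set0, set0), 0; rewrite /= mul0r subr0.
  by apply: ler_sum => x _; apply: ler_sum => y _; rewrite !mul0r addr0.
rewrite /eps_regular dAB /= => /forallPn[X /forallPn[Y]].
rewrite negb_imply -ltNge => /andP[/and4P[XA YB eX eY] dd].
have pos (S : {set V}) (T : {set V}) : eps * #|T|%:R < #|S|%:R -> (0 < #|S|)%N.
  move=> h; rewrite -(ltr0n R); apply: le_lt_trans h.
  by rewrite mulr_ge0 // ltW.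
have X0 := pos _ _ eX; have Y0 := pos _ _ eY.
have lXA : #|X|%:R <= #|A|%:R :> R by rewrite ler_nat subset_leq_card.
have lYB : #|Y|%:R <= #|B|%:R :> R by rewrite ler_nat subset_leq_card.
have A0 : 0 < #|A|%:R :> R by apply: lt_le_trans lXA; rewrite ltr0n.
have B0 : 0 < #|B|%:R :> R by apply: lt_le_trans lYB; rewrite ltr0n.
(* A witness inside [A] has more than [eps * #|A|] points. The bound serves when the chosen subpair
   is the whole cell. *)
have e1 : eps <= 1.
  by rewrite -(ler_pM2r A0) mul1r; apply: le_trans lXA; apply: ltW.
pose far (S T : {set V}) := eps / 2 <= `|density R e S T - g|.
have [S [T [SA TB S0 T0 [szST fST]]]] : exists S T : {set V},
   [/\ S \subset A, T \subset B, (0 < #|S|)%N, (0 < #|T|)%N &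
     eps^+2 * (#|A|%:R * #|B|%:R) <= #|S|%:R * #|T|%:R :> R /\ far S T].
  case: (lerP (eps / 2) `|density R e A B - g|) => [h|h].
    exists A, B; split => //; rewrite -?(ltr0n R) //; split=> //.
    rewrite ler_piMl ?mulr_ge0 ?ler0n // expr_le1 // ltW //.
  exists X, Y; split => //; split.
    rewrite expr2 mulrACA; apply: ler_pM; rewrite ?mulr_ge0 ?ler0n // ltW //.
  rewrite /far; have := ler_distD g (density R e A B) (density R e X Y).
  rewrite (distrC g); lra.
exists (S, T), (density R e S T - g); rewrite /= mul1r sqerr_correct // lerB //.
apply: (@le_trans _ _ ((eps / 2) ^+ 2 * (eps^+2 * (#|A|%:R * #|B|%:R)))).
  by rewrite le_eqVlt; apply/orP; left; apply/eqP; field.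
apply: ler_pM => //; first exact: sqr_ge0.
  by rewrite mulr_ge0 ?sqr_ge0 ?mulr_ge0 ?ler0n.
rewrite -[X in _ <= X]real_normK ?num_real //.
by apply: lerXn2r => //; rewrite nnegrE ?normr_ge0 ?divr_ge0 // ltW.
Qed.

(** * Equitable colourings with few mixed classes *)

Lemma card_index_lt (V : finType) (s : seq V) (a : nat) :
  uniq s -> (a <= size s)%N -> #|[set x in s | (index x s < a)%N]| = a.
Proof.
move=> us le_a; rewrite -[RHS](size_takel le_a) -(card_uniqP (take_uniq a us)).
apply: eq_card => x; rewrite inE.
have [xs|xs] := boolP (x \in s); first by rewrite in_take.
by apply/esym/negP => /mem_take; apply/negP.
Qed.

(* The element of rank [r] in an enumeration of [A] sorted by [sig] gets colour
   [r * k %/ #|A|]; a mixed class straddles the end of some fibre of [sig]. *)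
Lemma exists_equitable (V T : finType) (A : {set V}) (sig : V -> T) (k : nat) :
  (0 < k <= #|A|)%N ->
  exists c : V -> 'I_k, equitable A c /\ (#|mixed_colors A sig c| <= #|T|)%N.
Proof.
case/andP=> k0 kn; set n := #|A| in kn *; have n0 : (0 < n)%N by lia.
pose le x y := (enum_rank (sig x) <= enum_rank (sig y))%N.
have le_tot : total le by move=> x y; apply: leq_total.
have le_tr : transitive le by move=> x y z; apply: leq_trans.
have le_refl : reflexive le by move=> x; apply: leqnn.
pose s := sort le (enum A).
have us : uniq s by rewrite sort_uniq enum_uniq.
have sz : size s = n by rewrite size_sort -cardE.
have mems x : (x \in s) = (x \in A) by rewrite mem_sort mem_enum.
have idx x : x \in A -> (index x s < n)%N by rewrite -mems -index_mem sz.
(* The default is reached only outside [A], where the index is [n] and the quotient is [k]. *)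
pose c x : 'I_k := insubd (Ordinal k0) ((index x s * k) %/ n)%N.
have cE x : x \in A -> c x = (index x s * k %/ n)%N :> nat.
  move=> /idx xA; rewrite /c val_insubd ltn_divLR // [X in (_ < X)%N]mulnC.
  by rewrite ltn_pmul2r // xA.
have cLt x y : x \in A -> y \in A -> (c x < c y)%N -> (index x s < index y s)%N.
  move=> xA yA; rewrite !cE // !ltnNge; apply: contra => h.
  by rewrite leq_div2r // leq_mul2r h orbT.
have sigle x y : x \in A -> y \in A -> (index x s < index y s)%N -> le x y.
  rewrite -!mems => xA yA h.
  have := sorted_leq_index le_tr le_refl (sort_sorted le_tot (enum A)).
  by move/(_ x y xA yA (ltnW h)).
exists c; split.
  (* [b j] is [j * n / k] rounded up; class [i] holds the ranks from [b i] up to, but excluding,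
     [b i.+1]. *)
  move=> i; pose b j := ((j * n + k.-1) %/ k)%N.
  have bP r j : (r < b j)%N = (r * k < j * n)%N.
    by rewrite /b leq_divRL //; lia.
  have bn j : (j <= k)%N -> (b j <= n)%N.
    by move=> jk; rewrite leqNgt bP -leqNgt mulnC leq_mul2l jk orbT.
  have cnt j : (j <= k)%N -> #|[set x in A | (index x s < b j)%N]| = b j.
    move=> jk; rewrite -[RHS](card_index_lt us) ?sz ?bn //.
    by apply: eq_card => x; rewrite !inE /= mems.
  have -> : color_class A c i =
      [set x in A | (index x s < b i.+1)%N] :\: [set x in A | (index x s < b i)%N].
    apply/setP => x; rewrite !inE; case: (boolP (x \in A)) => //= xA.
    rewrite -val_eqE /= cE // !bP -leqNgt eqn_leq -ltnS ltn_divLR // leq_divRL //.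
    by rewrite andbC.
  have sub : [set x in A | (index x s < b i)%N] \subset
             [set x in A | (index x s < b i.+1)%N].
    apply/subsetP=> x; rewrite !inE => /andP[-> /=]; rewrite !bP => h.
    by apply: leq_trans h _; rewrite leq_mul2r leqnSn orbT.
  rewrite cardsD (setIidPr sub) !cnt //; last exact: ltnW.
  have h1 := leq_divM (i * n + k.-1) k; have h2 := ltn_ceil (i * n + k.-1) k0.
  have h3 := leq_divM (i.+1 * n + k.-1) k.
  have h4 := ltn_ceil (i.+1 * n + k.-1) k0.
  rewrite -/(b i) -/(b i.+1) in h1 h2 h3 h4.
  have h5 := leq_divM n k; have h6 := ltn_ceil n k0.
  move: (b i) (b i.+1) (n %/ k)%N h1 h2 h3 h4 h5 h6 => u v q *.
  (* The class size [v - u] lies between [q] and [q.+1]; multiplying by [k] removes the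
     quotients. *)
  have g1 : (q + u < v.+1)%N by rewrite -(ltn_pmul2r k0); lia.
  have g2 : (v < q.+1 + u.+1)%N by rewrite -(ltn_pmul2r k0); lia.
  by lia.
(* A mixed colour is charged to a signature present in its class that is not the last one there. *)
have pick i : exists t : T, i \in mixed_colors A sig c ->
    exists x y, [/\ x \in A, y \in A, c x = i, c y = i &
                    t = sig x /\ (enum_rank t < enum_rank (sig y))%N].
  case: (boolP (i \in _)) => [|_]; last first.
    have [x xA] : exists x, x \in A by apply/card_gt0P.
    by exists (sig x).
  rewrite inE => /existsP[x /andP[xi /existsP[y /andP[yi xy]]]].
  move: xi yi; rewrite !inE => /andP[xA /eqP xi] /andP[yA /eqP yi].
  have : enum_rank (sig x) != enum_rank (sig y).
    by apply: contra xy => /eqP/enum_rank_inj ->.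
  rewrite -val_eqE neq_ltn => /orP[h|h].
    by exists (sig x) => _; exists x, y.
  by exists (sig y) => _; exists y, x.
have [tau tauP] := fin_all_exists pick.
apply: (@leq_card_in _ _ tau) => //.
(* For [i < j], a point of class [i] with signature beyond [tau i] precedes the point of class [j]
   with signature [tau j], so [tau] is strictly increasing on mixed colours. *)
suff lt i j : i \in mixed_colors A sig c -> j \in mixed_colors A sig c ->
    (i < j)%N -> (enum_rank (tau i) < enum_rank (tau j))%N.
  move=> i j iM jM ij; apply: val_inj; case: (ltngtP i j) => // h.
    by have := lt _ _ iM jM h; rewrite ij ltnn.
  by have := lt _ _ jM iM h; rewrite ij ltnn.
move=> /tauP[x [y [xA yA xi yi [-> h]]]] /tauP[x' [y' [xA' yA' xj yj [-> _]]]] ij.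
apply: leq_trans h _; apply: sigle => //; apply: cLt => //.
by rewrite yi xj.
Qed.

(** * Summing the gain over all cells of a pair of classes *)

Lemma sum_color_class (U : nmodType) (V I : finType) (A : {set V})
    (c : V -> I) (F : V -> U) :
  \sum_(x in A) F x = \sum_i \sum_(x in color_class A c i) F x.
Proof.
rewrite (partition_big c xpredT) //=; apply: eq_bigr => i _.
by apply: eq_bigl => x; rewrite inE.
Qed.

Lemma sqerr_cells (R : realType) (V I J : finType) (e : rel V)
    (A B : {set V}) (c : V -> I) (d : V -> J) (G : I -> J -> V -> V -> R) :
  sqerr e A B (fun x y => G (c x) (d y) x y) =
  \sum_i \sum_j sqerr e (color_class A c i) (color_class B d j) (G i j).
Proof.
rewrite /sqerr (sum_color_class _ c); apply: eq_bigr => i _.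
rewrite [RHS]exchange_big /=; apply: eq_bigr => x; rewrite inE => /andP[_ /eqP <-].
rewrite (sum_color_class _ d); apply: eq_bigr => j _; apply: eq_bigr => y.
by rewrite inE => /andP[_ /eqP <-].
Qed.

Lemma pair_gain (R : realType) (V : finType) (e : rel V) (eps : R)
    (A B : {set V}) (I J : finType) (c : V -> I) (d : V -> J)
    (g : I -> J -> R) : 0 < eps -> [disjoint A & B] ->
  exists XY : I -> J -> {set V} * {set V}, exists eta : I -> J -> R,
   sqerr e A B (fun x y => g (c x) (d y) + eta (c x) (d y) *
      (x \in (XY (c x) (d y)).1)%:R * (y \in (XY (c x) (d y)).2)%:R) <=
   sqerr e A B (fun x y => g (c x) (d y)) -
   \sum_i \sum_j
     (~~ eps_regular e eps (color_class A c i) (color_class B d j))%:R *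
     (eps ^+ 4 / 4 * (#|color_class A c i|%:R * #|color_class B d j|%:R)).
Proof.
move=> e0 dAB.
have H i j := @cell_gain R V e eps (g i j) (color_class A c i)
  (color_class B d j) e0.
have dis i j : [disjoint color_class A c i & color_class B d j].
  apply: disjointW dAB; apply/subsetP => x; rewrite inE; by case/andP.
have [XY XYP] := fin_all_exists (fun i => fin_all_exists (fun j => H i j (dis i j))).
have [eta etaP] := fin_all_exists (fun i => fin_all_exists (XYP i)).
exists XY, eta.
rewrite (sqerr_cells _ _ _ _ _ (fun i j x y => g i j + eta i j *
  (x \in (XY i j).1)%:R * (y \in (XY i j).2)%:R)).
rewrite (sqerr_cells _ _ _ _ _ (fun i j x y => g i j)).
rewrite -sumrB; apply: ler_sum => i _; rewrite -sumrB; apply: ler_sum => j _.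
exact: etaP.
Qed.

(** * Rounding to an equitable colouring *)

Definition mixed_points (V T I : finType) (A : {set V}) (sig : V -> T)
    (c : V -> I) : {set V} := [set x in A | c x \in mixed_colors A sig c].

(** When neither colour of a cell is mixed, [G] is constant there and its value is kept. Any other
    cell gets 0, so each of its terms is at most 1 and is charged to a mixed point. *)
Lemma sqerr_round (R : realType) (V I J S T : finType) (e : rel V)
    (A B : {set V}) (c : V -> I) (d : V -> J) (sig : V -> S) (tau : V -> T)
    (G : S -> T -> R) :
  exists g : I -> J -> R,
   sqerr e A B (fun x y => g (c x) (d y)) <=
   sqerr e A B (fun x y => G (sig x) (tau y))
     + #|mixed_points A sig c|%:R * #|B|%:R
     + #|A|%:R * #|mixed_points B tau d|%:R.
Proof.
pose bad i j := (i \in mixed_colors A sig c) || (j \in mixed_colors B tau d).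
have H i j : exists v : R, forall x y, x \in color_class A c i ->
    y \in color_class B d j ->
    ((e x y)%:R - v) ^+ 2 <=
    ((e x y)%:R - G (sig x) (tau y)) ^+ 2 + (i \in mixed_colors A sig c)%:R
      + (j \in mixed_colors B tau d)%:R.
  have [bd|] := boolP (bad i j).
    exists 0 => x y _ _; rewrite subr0 -addrA; apply: (@le_trans _ _ 1).
      by case: (e x y); rewrite ?expr1n ?expr0n ?ler01.
    have := sqr_ge0 ((e x y)%:R - G (sig x) (tau y)).
    move: bd; rewrite /bad; case: (_ \in _) => /=; case: (_ \in _) => //= _; lra.
  rewrite negb_or => /andP[iM jM].
  have const (U W K : finType) (D : {set U}) (f : U -> W) (h : U -> K) l x y :
      l \notin mixed_colors D f h -> x \in color_class D h l ->
      y \in color_class D h l -> f x = f y.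
    rewrite inE => /existsPn /(_ x) hx xD yD; move: hx; rewrite xD /=.
    by move=> /existsPn /(_ y); rewrite yD /= negbK => /eqP.
  have [[x0 x0A]|noA] := altP (set0Pn (color_class A c i)); last first.
    exists 0 => x y xA; move: noA; rewrite negbK => /eqP A0.
    by rewrite A0 inE in xA.
  have [[y0 y0B]|noB] := altP (set0Pn (color_class B d j)); last first.
    exists 0 => x y _ yB; move: noB; rewrite negbK => /eqP B0.
    by rewrite B0 inE in yB.
  exists (G (sig x0) (tau y0)) => x y xA yB.
  rewrite (const _ _ _ _ _ _ _ _ _ iM x0A xA) (const _ _ _ _ _ _ _ _ _ jM y0B yB).
  by rewrite -addrA lerDl addr_ge0 ?ler0n.
have [g gP] := fin_all_exists (fun i => fin_all_exists (H i)).
exists g.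
have mixE (W K : finType) (D : {set V}) (f : V -> W) (h : V -> K) :
    #|mixed_points D f h|%:R = \sum_(x in D) (h x \in mixed_colors D f h)%:R :> R.
  rewrite /mixed_points -sum1dep_card natr_sum [LHS]big_mkcondr /=.
  by apply: eq_bigr => x _; case: ifP.
rewrite !mixE mulr_suml.
have -> : #|A|%:R * \sum_(x in B) (d x \in mixed_colors B tau d)%:R =
   \sum_(x in A) \sum_(y in B) (d y \in mixed_colors B tau d)%:R :> R.
  by rewrite [RHS]sumr_const mulr_natl.
rewrite -!big_split /=; apply: ler_sum => x xA.
have -> : (c x \in mixed_colors A sig c)%:R * #|B|%:R =
   \sum_(y in B) (c x \in mixed_colors A sig c)%:R :> R.
  by rewrite sumr_const mulr_natr.
rewrite -!big_split /=; apply: ler_sum => y yB.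
by apply: gP; rewrite inE eqxx ?xA ?yB.
Qed.

(** A class has at most [#|A| %/ k + 1] points, and [k <= #|A|] absorbs the extra point into the
    factor 2. *)
Lemma equitable_card_le (V : finType) (A : {set V}) (k : nat) (c : V -> 'I_k) i :
  (k <= #|A|)%N -> equitable A c -> (k * #|color_class A c i| <= 2 * #|A|)%N.
Proof.
move=> kA /(_ i) /andP[_ h].
have := leq_divM #|A| k; move: (_ %/ _)%N h => q h; nia.
Qed.

(** Here [k <= #|A|] makes the quotient at least 1, so adding 1 at most doubles it. *)
Lemma equitable_card_ge (V : finType) (A : {set V}) (k : nat) (c : V -> 'I_k) i :
  (k <= #|A|)%N -> equitable A c -> (#|A| <= 2 * (k * #|color_class A c i|))%N.
Proof.
move=> kA /(_ i) /andP[h _].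
have k0 : (0 < k)%N by apply: leq_ltn_trans (ltn_ord i).
have := ltn_ceil #|A| k0; have : (0 < #|A| %/ k)%N by rewrite divn_gt0.
move: (_ %/ _)%N h => q h; nia.
Qed.

Lemma card_mixed_points (V T : finType) (A : {set V}) (sig : V -> T) (k : nat)
    (c : V -> 'I_k) : (k <= #|A|)%N -> equitable A c ->
  (k * #|mixed_points A sig c| <= #|mixed_colors A sig c| * (2 * #|A|))%N.
Proof.
move=> kA eqc.
have -> : #|mixed_points A sig c| =
    (\sum_(i in mixed_colors A sig c) #|color_class A c i|)%N.
  rewrite -sum1_card (partition_big c (mem (mixed_colors A sig c))) /=.
    apply: eq_bigr => i iM; rewrite -sum1_card; apply: eq_bigl => x.
    rewrite !inE; case: eqP => [->|]; rewrite ?andbF ?andbT //.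
    by move: iM; rewrite inE => ->; rewrite andbT.
  by move=> x; rewrite inE => /andP[].
rewrite big_distrr /= -sum_nat_const; apply: leq_sum => i _.
exact: equitable_card_le.
Qed.

(** * The defect and one round of refinement *)

Definition defect (R : realType) (V I : finType) (e : rel V) (p : nat)
    (C : 'I_p -> {set V}) (c : 'I_p -> V -> I)
    (g : 'I_p -> 'I_p -> I -> I -> R) : R :=
  \sum_(s < p) \sum_(t : 'I_p | (s < t)%N)
    sqerr e (C s) (C t) (fun x y => g s t (c s x) (c t y))
      / (#|C s|%:R * #|C t|%:R).

Lemma defect_ge0 (R : realType) (V I : finType) (e : rel V) (p : nat)
    (C : 'I_p -> {set V}) (c : 'I_p -> V -> I)
    (g : 'I_p -> 'I_p -> I -> I -> R) : 0 <= defect e C c g.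
Proof.
apply: sumr_ge0 => s _; apply: sumr_ge0 => t _.
rewrite divr_ge0 ?mulr_ge0 ?ler0n //.
by apply: sumr_ge0 => x _; apply: sumr_ge0 => y _; apply: sqr_ge0.
Qed.

Lemma sum_ltn_le (R : realType) (p : nat) (F : 'I_p -> 'I_p -> R) (a : R) :
  0 <= a -> (forall s t : 'I_p, (s < t)%N -> F s t <= a) ->
  \sum_(s < p) \sum_(t : 'I_p | (s < t)%N) F s t <= p%:R ^+ 2 * a.
Proof.
move=> a0 Fa; apply: (@le_trans _ _ (\sum_(s < p) \sum_(t < p) a)).
  apply: ler_sum => s _; rewrite big_mkcond /=; apply: ler_sum => t _.
  by case: ifP => // /Fa.
by rewrite !sumr_const !card_ord -mulrnA -natrX expnS expn1 mulr_natl.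
Qed.

Lemma defect0_le (R : realType) (V I : finType) (e : rel V) (p : nat)
    (C : 'I_p -> {set V}) (c : 'I_p -> V -> I) :
  defect e C c (fun _ _ _ _ => 0 : R) <= p%:R ^+ 2.
Proof.
rewrite -[leRHS]mulr1; apply: sum_ltn_le => // s t _.
(* If a class is empty, the inverse of 0 is 0 and the term vanishes. *)
have [/eqP h|h] := boolP (#|C s|%:R * #|C t|%:R == 0 :> R).
  by rewrite h invr0 mulr0.
rewrite ler_pdivrMr ?mul1r; last by rewrite lt_def h mulr_ge0 ?ler0n.
apply: (@le_trans _ _ (\sum_(x in C s) \sum_(y in C t) 1)).
  apply: ler_sum => x _; apply: ler_sum => y _; rewrite subr0.
  by case: (e x y); rewrite ?expr1n ?expr0n.
by rewrite !sumr_const -[leLHS]mulr_natr mulrC.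
Qed.

Lemma card_irregular_pairs (R : realType) (V : finType) (e : rel V) (eps : R)
    (p k : nat) (W : 'I_p -> 'I_k -> {set V}) :
  #|irregular_pairs e eps W|%:R =
  \sum_(s < p) \sum_(t : 'I_p | (s < t)%N) \sum_i \sum_j
    (~~ eps_regular e eps (W s i) (W t j))%:R :> R.
Proof.
have -> : #|irregular_pairs e eps W|%:R =
   \sum_(u : 'I_p * 'I_k) \sum_(v : 'I_p * 'I_k)
     ((u.1 < v.1)%N && ~~ eps_regular e eps (W u.1 u.2) (W v.1 v.2))%:R :> R.
  rewrite pair_big /= /irregular_pairs -sum1dep_card natr_sum big_mkcond /=.
  by apply: eq_bigr => q _; case: ifP.
rewrite -(pair_big xpredT xpredT (fun (s : 'I_p) i => \sum_(v : 'I_p * 'I_k)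
     ((s < v.1)%N && ~~ eps_regular e eps (W s i) (W v.1 v.2))%:R)) /=.
apply: eq_bigr => s _.
under eq_bigr => i _ do rewrite -(pair_big xpredT xpredT (fun (t : 'I_p) j =>
     ((s < t)%N && ~~ eps_regular e eps (W s i) (W t j))%:R)) /=.
rewrite exchange_big /= [RHS]big_mkcond /=; apply: eq_bigr => t _.
case: ifP => // _; by rewrite big1 // => i _; rewrite big1.
Qed.

(* The colour of a point, and for each cell [(t, j)] whether the point lies in
   the first (resp. second) half of the witness pair chosen with that cell. *)
Definition signature (p k : nat) : finType :=
  ('I_k * {ffun 'I_p * 'I_k -> bool * bool})%type.

(** Each part has at least [1 / (2 * k)] of its class, which turns the cell gain [eps ^+ 4 / 4] into
    [eps ^+ 4 / (16 * k ^ 2)] per irregular pair. In each class at most [#|signature p k|] new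
    colours are mixed, each with at most [2 / k'] of the points; two classes per pair give the 4,
    and [p ^ 2] bounds the number of pairs. *)
Lemma defect_step (R : realType) (V : finType) (e : rel V) (eps : R)
    (p k k' : nat) (C : 'I_p -> {set V}) (c : 'I_p -> V -> 'I_k)
    (g : 'I_p -> 'I_p -> 'I_k -> 'I_k -> R) :
  0 < eps -> (forall s t : 'I_p, s != t -> [disjoint C s & C t]) ->
  (0 < k)%N -> (forall s, (k <= #|C s|)%N) -> (forall s, equitable (C s) (c s)) ->
  (0 < k')%N -> (forall s, (k' <= #|C s|)%N) ->
  exists (c' : 'I_p -> V -> 'I_k') (g' : 'I_p -> 'I_p -> 'I_k' -> 'I_k' -> R),
    (forall s, equitable (C s) (c' s)) /\
    defect e C c' g' <= defect e C c g
      - eps ^+ 4 / (16 * k%:R ^+ 2)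
        * #|irregular_pairs e eps (fun s => color_class (C s) (c s))|%:R
      + p%:R ^+ 2 * (4 * #|signature p k|%:R / k'%:R).
Proof.
move=> e0 dC k0 kC eqc k'0 k'C.
(* The condition [s < t] sits under the existentials so that witnesses can be chosen for all [s] and
   [t] at once. *)
have H (s t : 'I_p) : exists XY : 'I_k -> 'I_k -> {set V} * {set V},
    exists eta : 'I_k -> 'I_k -> R, (s < t)%N ->
   sqerr e (C s) (C t) (fun x y => g s t (c s x) (c t y) +
      eta (c s x) (c t y) * (x \in (XY (c s x) (c t y)).1)%:R
        * (y \in (XY (c s x) (c t y)).2)%:R) <=
   sqerr e (C s) (C t) (fun x y => g s t (c s x) (c t y)) -
   \sum_i \sum_j
     (~~ eps_regular e eps (color_class (C s) (c s) i)
        (color_class (C t) (c t) j))%:R *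
     (eps ^+ 4 / 4 * (#|color_class (C s) (c s) i|%:R
        * #|color_class (C t) (c t) j|%:R)).
  have [lt|_] := boolP (s < t)%N; last first.
    by exists (fun _ _ => (set0, set0)), (fun _ _ => 0).
  have [|XY [eta h]] := @pair_gain R V e eps (C s) (C t) _ _ (c s) (c t) (g s t) e0.
    by apply: dC; rewrite -val_eqE neq_ltn lt.
  by exists XY, eta.
have [XY XYP] := fin_all_exists (fun s => fin_all_exists (H s)).
have [eta gain] := fin_all_exists (fun s => fin_all_exists (XYP s)).
pose sig s x : signature p k := (c s x, [ffun tj : 'I_p * 'I_k =>
  (x \in (XY s tj.1 (c s x) tj.2).1, x \in (XY tj.1 s tj.2 (c s x)).2)]).
have He s := @exists_equitable V (signature p k) (C s) (sig s) k'.
have k'C' s : (0 < k' <= #|C s|)%N by rewrite k'0 k'C.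
have [c' c'P] := fin_all_exists (fun s => He s (k'C' s)).
(* Membership in the first half is read from the signature in [C s] at the cell of the other point,
   membership in the second half from the signature in [C t]. *)
pose G s t (u v : signature p k) := g s t u.1 v.1 +
  eta s t u.1 v.1 * (u.2 (t, v.1)).1%:R * (v.2 (s, u.1)).2%:R.
have [g' g'P] := fin_all_exists (fun s => fin_all_exists (fun t =>
  sqerr_round e (C s) (C t) (c' s) (c' t) (sig s) (sig t) (G s t))).
exists c', g'; split=> [s|]; first by case: (c'P s).
have C0 s : 0 < #|C s|%:R :> R by rewrite ltr0n (leq_trans k0).
have k0R : 0 < k%:R :> R by rewrite ltr0n.
have k'0R : 0 < k'%:R :> R by rewrite ltr0n.
have mixed s : #|mixed_points (C s) (sig s) (c' s)|%:R / #|C s|%:R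
    <= 2 * #|signature p k|%:R / k'%:R :> R.
  have [eq' mx] := c'P s.
  rewrite ler_pdivrMr // mulrAC ler_pdivlMr //.
  rewrite -!natrM ler_nat mulnC.
  apply: leq_trans (card_mixed_points _ (k'C s) eq') _.
  by apply: leq_trans (leq_mul mx (leqnn _)) _; rewrite mulnCA mulnA.
rewrite card_irregular_pairs.
pose L s t : R := #|mixed_points (C s) (sig s) (c' s)|%:R / #|C s|%:R
  + #|mixed_points (C t) (sig t) (c' t)|%:R / #|C t|%:R.
apply: (@le_trans _ _ (defect e C c g - eps ^+ 4 / (16 * k%:R ^+ 2) *
  (\sum_(s < p) \sum_(t : 'I_p | (s < t)%N) \sum_i \sum_j
    (~~ eps_regular e eps (color_class (C s) (c s) i)
          (color_class (C t) (c t) j))%:R)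
   + \sum_(s < p) \sum_(t : 'I_p | (s < t)%N) L s t)); last first.
  rewrite lerD2l; apply: sum_ltn_le => [|s t _].
    by rewrite divr_ge0 ?mulr_ge0 ?ler0n.
  apply: le_trans (lerD (mixed s) (mixed t)) _.
  by rewrite le_eqVlt; apply/orP; left; apply/eqP; field; rewrite gt_eqF.
rewrite /defect mulr_sumr -sumrB -big_split; apply: ler_sum => s _ /=.
rewrite mulr_sumr -sumrB -big_split; apply: ler_sum => t st /=.
have ab0 : 0 < #|C s|%:R * #|C t|%:R :> R by rewrite mulr_gt0.
rewrite ler_pdivrMr //; apply: le_trans (g'P s t) _.
have Geq : sqerr e (C s) (C t) (fun x y => G s t (sig s x) (sig t y)) =
   sqerr e (C s) (C t) (fun x y => g s t (c s x) (c t y) +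
      eta s t (c s x) (c t y) * (x \in (XY s t (c s x) (c t y)).1)%:R
        * (y \in (XY s t (c s x) (c t y)).2)%:R).
  apply: eq_bigr => x _; apply: eq_bigr => y _.
  by rewrite /G /sig /= !ffunE.
rewrite Geq mulrDl mulrBl divfK ?gt_eqF // -addrA; apply: lerD.
  apply: le_trans (gain s t st) _; apply: lerB => //.
  rewrite mulr_sumr mulr_suml; apply: ler_sum => i _.
  rewrite mulr_sumr mulr_suml; apply: ler_sum => j _.
  case: (~~ _); rewrite /= ?mulr0 ?mul0r // mulr1 mul1r.
  have ha : #|C s|%:R <= 2 * (k%:R * #|color_class (C s) (c s) i|%:R) :> R.
    by rewrite -!natrM ler_nat equitable_card_ge.
  have hb : #|C t|%:R <= 2 * (k%:R * #|color_class (C t) (c t) j|%:R) :> R.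
    by rewrite -!natrM ler_nat equitable_card_ge.
  have -> : eps ^+ 4 / 4 * (#|color_class (C s) (c s) i|%:R
       * #|color_class (C t) (c t) j|%:R) =
     eps ^+ 4 / (16 * k%:R ^+ 2) * ((2 * (k%:R * #|color_class (C s) (c s) i|%:R)) *
       (2 * (k%:R * #|color_class (C t) (c t) j|%:R))) :> R.
    by field; rewrite gt_eqF.
  apply: ler_wpM2l.
    by rewrite divr_ge0 ?mulr_ge0 ?exprn_ge0 ?ler0n // ltW.
  by apply: ler_pM.
rewrite /L le_eqVlt; apply/orP; left; apply/eqP; field.
by rewrite !gt_eqF.
Qed.

(** * From colourings to partitions, and the iteration *)

Lemma color_class_partition (V : finType) (A : {set V}) (k : nat)
    (c : V -> 'I_k) :
  (0 < k <= #|A|)%N -> equitable A c -> is_k_partition (color_class A c) A.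
Proof.
case/andP=> k0 kA eqc.
(* Since [k <= #|A|], no class is empty; this yields both injectivity and the absence of [set0]. *)
have ne i : exists x, x \in color_class A c i.
  apply/card_gt0P; case/andP: (eqc i) => h _.
  by apply: leq_trans h; rewrite divn_gt0.
split.
  move=> i j ij; have [x xi] := ne i; have := xi; rewrite ij.
  by move: xi; rewrite !inE => /andP[_ /eqP <-] /andP[_ /eqP <-].
apply/and3P; split.
- apply/eqP/setP => x; apply/bigcupP/idP.
    by case=> D /imsetP[i _ ->]; rewrite inE => /andP[].
  by move=> xA; exists (color_class A c (c x)); rewrite ?imset_f // inE xA eqxx.
- apply/trivIsetP => _ _ /imsetP[i _ ->] /imsetP[j _ ->] ij.
  apply/pred0P => x /=; rewrite !inE; apply: contraNF ij.
  by move=> /andP[/andP[_ /eqP <-] /andP[_ /eqP <-]].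
- by apply/imsetP => -[i _ h]; have [x] := ne i; rewrite -h inE.
Qed.

Lemma equitable_dist (V : finType) (A : {set V}) (k : nat) (c : V -> 'I_k) i j :
  equitable A c ->
  `|#|color_class A c i|%:Z - #|color_class A c j|%:Z| <= 1.
Proof.
by move=> eqc; move: (eqc i) (eqc j) => /andP[? ?] /andP[? ?]; lia.
Qed.

(** Induction on the budget [n] of rounds, for all [k], since a round changes [k]. [M] is fixed
    before the graph because the next [k'] depends only on [eps], [m], [p] and [k]. A zero budget
    contradicts the nonnegativity of the defect. *)
Lemma defect_iterate (R : realType) (eps : R) (m p n k : nat) :
  0 < eps -> (0 < m <= k)%N -> (2 <= p)%N ->
  exists M : nat, forall (V : finType) (e : rel V) (C : 'I_p -> {set V})
      (c : 'I_p -> V -> 'I_k) (g : 'I_p -> 'I_p -> 'I_k -> 'I_k -> R),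
    (forall s t : 'I_p, s != t -> [disjoint C s & C t]) ->
    (forall s, (M <= #|C s|)%N) -> (forall s, equitable (C s) (c s)) ->
    defect e C c g < n%:R * (eps ^+ 5 / 32) ->
    exists2 k', (m <= k' <= M)%N & exists c' : 'I_p -> V -> 'I_k',
      (forall s, equitable (C s) (c' s)) /\
      #|irregular_pairs e eps (fun s => color_class (C s) (c' s))|%:R
        <= eps * k'%:R ^+ 2 * 'C(p, 2)%:R.
Proof.
move=> e0 + p2; elim: n k => [|n IH] k /andP[m0 mk].
  exists 0%N => V e C c g _ _ _; rewrite mul0r => lt0.
  by have := defect_ge0 e C c g; rewrite leNgt lt0.
set gam := eps ^+ 5 / 32 in IH *.
have gam0 : 0 < gam by rewrite divr_gt0 ?exprn_gt0.
pose K := #|signature p k|.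
(* Large enough for the rounding loss to be at most [gam]. *)
pose k' := maxn m (Num.bound (p%:R ^+ 2 * (4 * K%:R) / gam)).
have mk' : (m <= k')%N by rewrite leq_maxl.
have [|M MP] := IH k'; first by rewrite m0.
(* The three terms allow stopping at [k], cutting into [k'] parts, and applying the induction
   hypothesis. *)
exists (maxn k (maxn k' M)) => V e C c g dC MC eqc dlt.
have kC s : (k <= #|C s|)%N by apply: leq_trans (MC s); rewrite leq_maxl.
have k'C s : (k' <= #|C s|)%N.
  by apply: leq_trans (MC s); rewrite leq_max leq_maxl orbT.
have MMC s : (M <= #|C s|)%N.
  by apply: leq_trans (MC s); rewrite !leq_max leqnn !orbT.
have k0 : (0 < k)%N by apply: leq_trans mk.
have k'0 : (0 < k')%N by apply: leq_trans mk'.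
have [reg|irr] := lerP #|irregular_pairs e eps (fun s => color_class (C s) (c s))|%:R
  (eps * k%:R ^+ 2 * 'C(p, 2)%:R).
  by exists k; [rewrite mk leq_maxl | exists c].
have [c' [g' [eqc' dle]]] := defect_step e g e0 dC k0 kC eqc k'0 k'C.
have [|k'' kk'' res] := MP V e C c' g' dC MMC eqc'.
  apply: le_lt_trans dle _.
  have k0R : 0 < k%:R :> R by rewrite ltr0n.
  have loss : p%:R ^+ 2 * (4 * K%:R / k'%:R) <= gam.
    rewrite mulrA ler_pdivrMr ?ltr0n // [leRHS]mulrC -ler_pdivrMr //.
    apply: le_trans (ltW (archi_boundP _)) _.
      by rewrite !mulr_ge0 ?invr_ge0 ?ler0n ?exprn_ge0 ?(ltW gam0) ?(ltW e0).
    by rewrite ler_nat leq_maxr.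
  (* As [p >= 2], there are more than [eps * k ^ 2] irregular pairs, so the gain is at least
     [eps ^+ 5 / 16], twice [gam]; the loss takes back at most one [gam]. *)
  have gn : 2 * gam <= eps ^+ 4 / (16 * k%:R ^+ 2) *
     #|irregular_pairs e eps (fun s => color_class (C s) (c s))|%:R.
    have -> : 2 * gam = eps ^+ 4 / (16 * k%:R ^+ 2) * (eps * k%:R ^+ 2).
      by rewrite /gam; field; rewrite gt_eqF.
    apply: ler_wpM2l; first by rewrite divr_ge0 ?mulr_ge0 ?exprn_ge0 // ltW.
    apply: le_trans (ltW irr); apply: ler_peMr.
      by rewrite mulr_ge0 ?exprn_ge0 ?ler0n ?(ltW e0).
    by rewrite ler1n bin_gt0.
  move: dlt; rewrite -natr1 mulrDl mul1r; lra.
exists k'' => //; case/andP: kk'' => -> h /=; by rewrite !leq_max h !orbT.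
Qed.

Theorem theorem2 (R : realType) (eps : R) (m p : nat)
    (eps_gt0 : 0 < eps) (m_ge1 : (1 <= m)%N) (p_ge2 : (2 <= p)%N) :
  exists M : nat,
    forall (V : finType) (e : rel V) (C : 'I_p -> {set V}),
      simple_graph e -> multipartite e C ->
      (forall s : 'I_p, (M <= #|C s|)%N) ->
      exists k : nat, (m <= k <= M)%N /\
        exists W : 'I_p -> 'I_k -> {set V},
          [/\ forall s : 'I_p, is_k_partition (W s) (C s),
              forall (s : 'I_p) (i j : 'I_k),
                `|#|W s i|%:Z - #|W s j|%:Z| <= 1
            & #|irregular_pairs e eps W|%:R <= eps * k%:R ^+ 2 * 'C(p, 2)%:R].
Proof.
pose gam := eps ^+ 5 / 32.
have gam0 : 0 < gam by rewrite divr_gt0 ?exprn_gt0.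
(* The zero function starts with defect at most [p ^ 2], below [n * gam]. *)
pose n := Num.bound (p%:R ^+ 2 / gam).
have [|M MP] := @defect_iterate R eps m p n m eps_gt0 _ p_ge2.
  by rewrite m_ge1 leqnn.
exists (maxn m M) => V e C _ [_ dC _] MC.
have mC s : (0 < m <= #|C s|)%N.
  by rewrite m_ge1; apply: leq_trans (MC s); rewrite leq_maxl.
have MMC s : (M <= #|C s|)%N by apply: leq_trans (MC s); rewrite leq_maxr.
(* A constant signature gives an arbitrary equitable colouring to start from. *)
have [c cP] := fin_all_exists (fun s =>
  exists_equitable (fun _ : V => tt) (mC s)).
have [||k /andP[mk kM] [c' [eqc reg]]] :=
    MP V e C c (fun _ _ _ _ => 0) dC MMC.
- by move=> s; case: (cP s).
- apply: le_lt_trans (defect0_le _ _ _ _) _.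
  by rewrite -ltr_pdivrMr // archi_boundP // divr_ge0 ?exprn_ge0 // ltW.
exists k; split; first by rewrite mk leq_max kM orbT.
exists (fun s => color_class (C s) (c' s)); split=> // [s|s i j].
  apply: color_class_partition => //.
  by rewrite (leq_trans m_ge1 mk) (leq_trans kM) ?MMC.
exact: equitable_dist.
Qed.
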